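(* Let $\Lambda$ be an uncountable totally ordered set, and let $W$ be P. Hall's ordered (generalized) wreath product over the index set $\Lambda$ of groups $H_\lambda$ $(\lambda\in\Lambda)$, where every $H_\lambda$ is a copy of $\mathbb{Z}$. Then $W$ does not embed in $PLo(I)$, i.e. there is no injective group homomorphism $W\to PLo(I)$.
   Context: $PLo(I)$ denotes the group (under composition) of piecewise linear orientation-preserving homeomorphisms of the unit interval $I=[0,1]$ having only finitely many points of non-differentiability. P. Hall's ordered wreath product of copies of $\mathbb{Z}$ over a totally ordered set $\Lambda$: let each $H_\lambda=\mathbb{Z}$ act on the set $X_\lambda=\mathbb{Z}$ by translation, with base point $0\in X_\lambda$. Let $X$ be the set of all functions $x:\Lambda\to\mathbb{Z}$, $\lambda\mapsto x_\lambda$, with $x_\lambda=0$ for all but finitely many $\lambda$. For $\lambda\in\Lambda$ and $h\in H_\lambda=\mathbb{Z}$ define a permutation $\sigma_{\lambda,h}$ of $X$ as follows: if $x_\mu=0$ for all $\mu>\lambda$, then $x\sigma_{\lambda,h}=y$, where $y_\lambda=x_\lambda+h$ and $y_\mu=x_\mu$ for $\mu\neq\lambda$; otherwise $x\sigma_{\lambda,h}=x$. The wreath product $W$ is the subgroup of the symmetric group on $X$ generated by all $\sigma_{\lambda,h}$, $\lambda\in\Lambda$, $h\in\mathbb{Z}$. *)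

(* Defs.v *)
From HB Require Import structures.
From mathcomp Require Export all_boot all_order all_algebra finmap.
From mathcomp Require Export all_classical all_reals all_analysis.

Set Implicit Arguments.
Unset Strict Implicit.
Unset Printing Implicit Defensive.

Import Order.TTheory GRing.Theory Num.Theory.
Export numFieldNormedType.Exports.

Local Open Scope classical_set_scope.
Local Open Scope ring_scope.

(* The symmetric group on a (possibly infinite) type. Permutations act on the
   right, as for [{perm T}]: (f * g) x = g (f x). *)

Record sym (T : Type) : Type := Sym {
  sym_fun :> T -> T;
  sym_inv : T -> T;
  symK : cancel sym_fun sym_inv;
  symVK : cancel sym_inv sym_fun }.

HB.instance Definition _ (T : Type) := gen_eqMixin (sym T).
HB.instance Definition _ (T : Type) := gen_choiceMixin (sym T).

Lemma symP (T : Type) (f g : sym T) : f =1 g -> f = g.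
Proof.
case: f g => [f f' fK f'K] [g g' gK g'K] /= /funext fg.
have f'g' : f' = g' by apply/funext => x; rewrite -{1}(g'K x) -fg fK.
by subst g g'; congr Sym; exact: Prop_irrelevance.
Qed.

Definition sym_one (T : Type) : sym T :=
  @Sym T id id (fun=> erefl) (fun=> erefl).

Definition sym_opp (T : Type) (f : sym T) : sym T := Sym (symVK f) (symK f).

Definition sym_mul (T : Type) (f g : sym T) : sym T :=
  @Sym T (g \o f) (sym_inv f \o sym_inv g)
    (can_comp (symK g) (symK f)) (can_comp (symVK f) (symVK g)).

Fact sym_mulA (T : Type) : associative (@sym_mul T).
Proof. by move=> f g h; exact: symP. Qed.

Fact sym_mul1g (T : Type) : left_id (sym_one T) (@sym_mul T).
Proof. by move=> f; exact: symP. Qed.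

Fact sym_mulg1 (T : Type) : right_id (sym_one T) (@sym_mul T).
Proof. by move=> f; exact: symP. Qed.

Fact sym_mulVg (T : Type) : left_inverse (sym_one T) (@sym_opp T) (@sym_mul T).
Proof. by move=> f; apply: symP => x /=; rewrite symVK. Qed.

Fact sym_mulgV (T : Type) : right_inverse (sym_one T) (@sym_opp T) (@sym_mul T).
Proof. by move=> f; apply: symP => x /=; rewrite symK. Qed.

HB.instance Definition _ (T : Type) := isGroup.Build (sym T)
  (@sym_mulA T) (@sym_mul1g T) (@sym_mulg1 T) (@sym_mulVg T) (@sym_mulgV T).

Definition generated (G : groupType) (S : set G) : set G :=
  smallest [set H : set G | group_closed (mem H)] S.

Fact generated_closed (G : groupType) (S : set G) : group_closed (mem (generated S)).
Proof.
split; first by apply/mem_set => H [[/set_mem H1 _] _].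
move=> x y /set_mem Sx /set_mem Sy; apply/mem_set => H HS.
by apply/set_mem/HS.1.2; apply/mem_set; [exact: Sx | exact: Sy].
Qed.

(* P. Hall's ordered wreath product of copies of Z over Lambda: the base point
   of every X_lambda = Z is 0, and [hall_shift l h] is sigma_(l, h). *)

Notation hall_space Lambda := {fsfun Lambda -> int with 0}.

Definition hall_shift_fun (d : Order.disp_t) (Lambda : orderType d)
    (l : Lambda) (h : int) (x : hall_space Lambda) : hall_space Lambda :=
  if `[< forall m : Lambda, (l < m)%O -> x m = 0 >]
  then [fsfun x with l |-> x l + h] else x.

Fact hall_shift_funK (d : Order.disp_t) (Lambda : orderType d)
    (l : Lambda) (h h' : int) : h + h' = 0 ->
  cancel (@hall_shift_fun d Lambda l h) (hall_shift_fun l h').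
Proof.
move=> hh' x; rewrite /hall_shift_fun.
have [x0|x0] := pselect (forall m, (l < m)%O -> x m = 0); last first.
  by rewrite !(asboolF x0).
rewrite (asboolT x0).
rewrite asboolT; last first.
  by move=> m lm; rewrite fsfun_withE gt_eqF // x0.
apply/fsfunP => m; rewrite !fsfun_withE eqxx.
by case: eqVneq => [->|//]; rewrite -addrA hh' addr0.
Qed.

Definition hall_shift (d : Order.disp_t) (Lambda : orderType d)
    (l : Lambda) (h : int) : sym (hall_space Lambda) :=
  Sym (hall_shift_funK l (addrN h)) (hall_shift_funK l (addNr h)).

Definition hall_generators (d : Order.disp_t) (Lambda : orderType d) :
    set (sym (hall_space Lambda)) :=
  [set s | exists (l : Lambda) (h : int), s = hall_shift l h].

Record hall_wreath (d : Order.disp_t) (Lambda : orderType d) := HallWreath {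
  hall_wreath_val :> sym (hall_space Lambda);
  _ : hall_wreath_val \in generated (@hall_generators d Lambda) }.

HB.instance Definition _ (d : Order.disp_t) (Lambda : orderType d) :=
  [isSub for @hall_wreath_val d Lambda].
HB.instance Definition _ (d : Order.disp_t) (Lambda : orderType d) :=
  [Choice of hall_wreath Lambda by <:].
HB.instance Definition _ (d : Order.disp_t) (Lambda : orderType d) :=
  SubChoice_isSubGroup.Build _ _ (hall_wreath Lambda)
    (generated_closed (@hall_generators d Lambda)).

(* As a type, [unit_itv R] carries the subspace topology. *)
Definition unit_itv (R : realType) : set R := `[0, 1].
Arguments unit_itv : clear implicits.

Definition affine_between (R : realType) (f : unit_itv R -> unit_itv R)
    (a b : unit_itv R) : Prop :=
  exists m k : R, forall x : unit_itv R,
    val a <= val x <= val b -> val (f x) = m * val x + k.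

(* For continuous f, the set B contains all the points of non-differentiability
   (breakpoints); it is allowed to be larger. *)
Definition piecewise_linear (R : realType)
    (f : unit_itv R -> unit_itv R) : Prop :=
  exists2 B : set (unit_itv R), finite_set B &
    forall a b : unit_itv R,
      (forall c, B c -> ~ (val a < val c < val b)) -> affine_between f a b.

Definition PLo_set (R : realType) : set (sym (unit_itv R)) :=
  [set f : sym (unit_itv R) |
           [/\ continuous (f : unit_itv R -> unit_itv R),
               continuous (sym_inv f),
               forall x y, val x < val y -> val (f x) < val (f y) &
               piecewise_linear f]].

Fact sym_inv_lt (R : realType) (f : sym (unit_itv R)) :
    (forall x y, val x < val y -> val (f x) < val (f y)) ->
  forall x y, val x < val y -> val (sym_inv f x) < val (sym_inv f y).
Proof.
move=> f_lt x y xy; case: ltgtP => //.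
- by move=> /f_lt; rewrite !symVK => /(lt_trans xy); rewrite ltxx.
- by move=> /val_inj /(congr1 f); rewrite !symVK => e; rewrite e ltxx in xy.
Qed.

Fact lt_mono_le (R : realType) (f : unit_itv R -> unit_itv R) :
    (forall x y, val x < val y -> val (f x) < val (f y)) ->
  forall x y, val x <= val y -> val (f x) <= val (f y).
Proof.
move=> f_lt x y; rewrite le_eqVlt => /predU1P[/val_inj ->//|/f_lt].
exact: ltW.
Qed.

Fact piecewise_linear_inv (R : realType) (f : sym (unit_itv R)) :
    (forall x y, val x < val y -> val (f x) < val (f y)) ->
  piecewise_linear f -> piecewise_linear (sym_inv f).
Proof.
move=> f_lt [B Bfin Baff].
have g_lt := sym_inv_lt f_lt; have g_le := lt_mono_le g_lt.
exists (f @` B); first exact: finite_image.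
move=> a b ab; have [|m [k fE]] := Baff (sym_inv f a) (sym_inv f b).
  move=> c Bc /andP[ac cb]; apply: (ab (f c)); first by exists c.
  by rewrite -[a](symVK f) -[b](symVK f) !f_lt.
have xE (x : unit_itv R) : val a <= val x <= val b ->
    val x = m * val (sym_inv f x) + k.
  by move=> /andP[ax xb]; rewrite -fE ?symVK// !g_le.
have [m0|m0] := eqVneq m 0.
  exists 0, (val (sym_inv f a)) => x /[dup] axb /andP[ax xb].
  have /xE aE : val a <= val a <= val b by rewrite lexx (le_trans ax xb).
  have -> : x = a by apply: val_inj; rewrite (xE x)// aE m0 !mul0r.
  by rewrite mul0r add0r.
exists m^-1, (- (m^-1 * k)) => x axb.
by rewrite (xE x axb) mulrDr mulKf// addrK.
Qed.

Fact piecewise_linear_comp (R : realType) (f g : sym (unit_itv R)) :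
    (forall x y, val x < val y -> val (f x) < val (f y)) ->
  piecewise_linear f -> piecewise_linear g -> piecewise_linear (g \o f).
Proof.
move=> f_lt [B Bfin Baff] [C Cfin Caff].
have f_le := lt_mono_le f_lt.
exists (B `|` sym_inv f @` C).
  by rewrite finite_setU; split=> //; exact: finite_image.
move=> a b ab; have [|m [k fE]] := Baff a b.
  by move=> c Bc; apply: ab; left.
have [|m' [k' gE]] := Caff (f a) (f b).
  move=> c Cc /andP[ac cb]; apply: (ab (sym_inv f c)).
    by right; exists c.
  by rewrite -[a](symK f) -[b](symK f) !(sym_inv_lt f_lt).
exists (m' * m), (m' * k + k') => x /[dup] axb /andP[ax xb] /=.
by rewrite gE ?f_le// fE// mulrDr mulrA addrA.
Qed.

Fact PLo_closed (R : realType) : group_closed (mem (@PLo_set R)).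
Proof.
split.
  apply/mem_set; split=> //; try by move=> x; exact: cvg_id.
  exists set0 => // a b _; exists 1, 0 => x _.
  by rewrite mul1r addr0.
move=> f g /set_mem[fc fc' f_lt fpl] /set_mem[gc gc' g_lt gpl].
have gV_lt := sym_inv_lt g_lt.
apply/mem_set; split.
- by move=> x; apply: continuous_comp; [exact: fc | exact: gc'].
- by move=> x; apply: continuous_comp; [exact: gc | exact: fc'].
- by move=> x y /f_lt; exact: gV_lt.
- apply: (@piecewise_linear_comp R f (g^-1)%g) => //.
  exact: piecewise_linear_inv.
Qed.

Record PLo (R : realType) := MkPLo {
  PLo_val :> sym (unit_itv R);
  _ : PLo_val \in @PLo_set R }.

HB.instance Definition _ (R : realType) := [isSub for @PLo_val R].
HB.instance Definition _ (R : realType) := [Choice of PLo R by <:].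
HB.instance Definition _ (R : realType) :=
  SubChoice_isSubGroup.Build _ _ (PLo R) (@PLo_closed R).

(* Main.v *)
Require Import Defs.
From mathcomp Require Import lra.

(* For distinct indices l < m, the generators a = sigma_(l, 1) and
   b = sigma_(m, 1) do not commute, but a commutes with its conjugate by b. If
   f and g are elements of PLo(I) such that f commutes with f^g but differs
   from f^g, then g moves some component of the support of f off itself: an
   element commuting with f and fixing a point of such a component is the
   identity there, so that otherwise g would preserve every component, and f^g
   would agree with f near its left endpoint, hence everywhere. Now f has
   finitely many components, so it can be given a finite code consisting of
   rational pairs (q, r), one pair in each component, such that the images of q
   under f and f^-1 are less than r. If f and g had the same code, the images
   of q under g and g^-1 would be less than r as well, so g would not move any
   component of f off itself. Hence the generators have pairwise distinct
   codes, and there are only countably many codes. *)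

Set Implicit Arguments.
Unset Strict Implicit.
Unset Printing Implicit Defensive.

Import Order.TTheory GRing.Theory Num.Theory.

Local Open Scope classical_set_scope.
Local Open Scope ring_scope.

(** * The action of PLo(I) on the real line *)

Section PLAction.
Variable R : realType.
Implicit Types (f g h k : PLo R) (u v : unit_itv R) (x y z l e : R).

(** The default value [x] extends [f] by the identity off the unit interval. This gives an
    increasing bijection of the whole line and spares membership proofs. *)
Definition plact f x : R := oapp (fun u : unit_itv R => val (f u)) x (insub x).

Lemma plact_val f u : plact f (val u) = val (f u).
Proof. by rewrite /plact valK. Qed.

Variant unit_itv_spec x : R -> Prop :=
| InUnit u of x = val u & 0 <= val u <= 1 : unit_itv_spec x (val u)
| OutUnit of ~~ (0 <= x <= 1) : unit_itv_spec x x.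

Lemma unit_itv_bounds u : 0 <= val u <= 1.
Proof. by have := valP u; rewrite inE /unit_itv /= in_itv. Qed.

Lemma unit_itvP x : unit_itv_spec x x.
Proof.
have [x01|x01] := boolP (0 <= x <= 1); last exact: OutUnit.
have xP : x \in unit_itv R by rewrite inE /unit_itv /= in_itv.
have -> : x = val (Sub x xP : unit_itv R) by rewrite SubK.
by apply: InUnit => //; exact: unit_itv_bounds.
Qed.

Lemma plact_out f x : ~~ (0 <= x <= 1) -> plact f x = x.
Proof.
move=> x01; rewrite /plact insubN//; apply: contra x01.
by rewrite inE /unit_itv /= in_itv.
Qed.

Lemma plactM f g x : plact (f * g)%g x = plact g (plact f x).
Proof.
by case: (unit_itvP x) => [u _ _|x01]; rewrite ?plact_val ?(plact_out _ x01).
Qed.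

Lemma plact1 x : plact 1%g x = x.
Proof. by case: (unit_itvP x) => [u _ _|/plact_out//]; rewrite plact_val. Qed.

Lemma plactK f : cancel (plact f) (plact f^-1%g).
Proof. by move=> x; rewrite -plactM mulgV plact1. Qed.

Lemma plactVK f : cancel (plact f^-1%g) (plact f).
Proof. by move=> x; rewrite -plactM mulVg plact1. Qed.

Lemma plact_inj f : injective (plact f).
Proof. exact: can_inj (plactK f). Qed.

Lemma eq_plact f g : plact f =1 plact g -> f = g.
Proof.
move=> fg; apply/val_inj/symP => u; apply: val_inj.
by rewrite -!plact_val fg.
Qed.

Lemma ltr_plact f : {mono plact f : x y / x < y}.
Proof.
apply/leW_mono/le_mono => x y.
have [_ _ f_lt _] : PLo_set (val f) by have := valP f; rewrite inE.
case: (unit_itvP x) => [u _ u01|x01];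
  case: (unit_itvP y) => [v _ v01|y01]; rewrite ?plact_val ?(plact_out f)//.
- exact: f_lt.
- by move: u01 y01 (unit_itv_bounds (f u)); lra.
- by move: v01 x01 (unit_itv_bounds (f v)); lra.
Qed.

Lemma ler_plact f : {mono plact f : x y / x <= y}.
Proof. by move=> x y; rewrite !leNgt ltr_plact. Qed.

Lemma plact_in f x : 0 <= x <= 1 -> 0 <= plact f x <= 1.
Proof.
case: (unit_itvP x) => [u _ _|/negP//] _.
by rewrite plact_val unit_itv_bounds.
Qed.

Lemma plact0 f : plact f 0 = 0.
Proof.
have ge0 g : 0 <= plact g 0 by case/andP: (@plact_in g 0 ltac:(lra)).
by apply/eqP; rewrite eq_le ge0 andbT -(ler_plact f^-1%g) plactK ge0.
Qed.

Lemma plact_1 f : plact f 1 = 1.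
Proof.
have le1 g : plact g 1 <= 1 by case/andP: (@plact_in g 1 ltac:(lra)).
by apply/eqP; rewrite eq_le le1 /= -(ler_plact f^-1%g) plactK le1.
Qed.

Lemma plact_piecewise_affine f : exists B : seq R, forall a b, a < b ->
  (forall c, c \in B -> ~~ (a < c < b)) ->
  exists m k : R, forall x, a <= x <= b -> plact f x = m * x + k.
Proof.
have [_ _ _ [B Bfin Baff]] : PLo_set (val f) by have := valP f; rewrite inE.
have /finite_seqP[s sB] := Bfin.
(* The extension by the identity may have corners at 0 and 1. *)
exists (0 :: 1 :: map val s) => a b ab abs.
have /negP a0b : ~~ (a < 0 < b) by apply: abs; rewrite inE eqxx.
have /negP a1b : ~~ (a < 1 < b) by apply: abs; rewrite !inE eqxx orbT.
have [b0|b0] := leP b 0.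
  exists 1, 0 => x /andP[ax xb]; rewrite mul1r addr0.
  have [->|x0] := eqVneq x 0; first by rewrite plact0.
  by rewrite plact_out//; move: x0; lra.
have [a1|a1] := leP 1 a.
  exists 1, 0 => x /andP[ax xb]; rewrite mul1r addr0.
  have [->|x0] := eqVneq x 1; first by rewrite plact_1.
  by rewrite plact_out//; move: x0; lra.
have : 0 <= a <= 1 by move: a0b; lra.
have : 0 <= b <= 1 by move: a1b; lra.
case: (unit_itvP b) ab abs => [v _ _|/negP b01 //] ab abs.
case: (unit_itvP a) ab abs => [u _ _|/negP a01 //] ab abs.
move=> _ _; have [|m [k fE]] := Baff u v.
  move=> c; rewrite sB /= => cs; apply/negP/abs.
  by rewrite !inE map_f ?orbT.
exists m, k => x; case: (unit_itvP x) => [w _ _|x01] uxv.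
  by rewrite plact_val fE.
by move: x01 uxv (unit_itv_bounds u) (unit_itv_bounds v); lra.
Qed.

Lemma plact_right_germ f l : exists2 e, l < e &
  exists m k : R, forall x, l <= x <= e -> plact f x = m * x + k.
Proof.
have [B Baff] := plact_piecewise_affine f.
have [e le eB] : exists2 e, l < e & forall c, c \in B -> ~~ (l < c < e).
  elim: B {Baff} => [|b B [e le eB]]; first by exists (l + 1); [lra|].
  exists (if l < b then Order.min b e else e).
    by case: ifP => // lb; rewrite lt_min lb.
  move=> c; rewrite inE => /predU1P[->|/eB].
    by case: ifP => //= lb; rewrite lt_min ltxx ?andbF.
  apply: contra => /andP[-> /=]; case: ifP => // _.
  by rewrite lt_min => /andP[].
by exists e => //; exact: Baff.
Qed.

(** * Components of the support *)

(* [l] is the left endpoint of the component of the support of [f] that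
   contains [x]. *)
Definition bump f l x := [/\ plact f l = l, l < x &
  forall z, l < z <= x -> plact f z <> z].

Lemma bump_moved f l x : bump f l x -> plact f x <> x.
Proof. by move=> [_ lx]; apply; rewrite lx lexx. Qed.

Lemma bump_le f l x y : bump f l x -> l < y <= x -> bump f l y.
Proof.
move=> [fl lx fx] /andP[ly yx]; split=> // z /andP[lz zy].
by apply: fx; rewrite lz (le_trans zy).
Qed.

Lemma bump_exists f x : plact f x <> x -> exists l, bump f l x.
Proof.
move=> fx; have /andP[x0 _] : 0 <= x <= 1.
  by apply/negPn/negP => /(plact_out f).
pose E := [set z | plact f z = z /\ z <= x].
have E0 : E !=set0 by exists 0; rewrite /E /= plact0.
have Ex : ubound E x by move=> z [].
have ubE : ubound E (sup E) by apply: sup_upper_bound; split; last by exists x.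
(* Monotonicity suffices here. Applied to [f] and to its inverse, this makes [sup E] a fixed
   point. *)
have fE g : (forall z, E z -> plact g z = z) -> sup E <= plact g (sup E).
  by move=> gE; apply: ge_sup => // z Ez; rewrite -(gE z Ez) ler_plact ubE.
have fl : plact f (sup E) = sup E.
  apply/eqP; rewrite eq_le fE ?andbT; last by move=> z [].
  rewrite -(ler_plact f^-1%g) plactK fE// => z [fz _].
  by rewrite -{1}fz plactK.
have lx : sup E <= x by exact: ge_sup.
exists (sup E); split=> //.
  by rewrite lt_neqAle lx andbT; apply/eqP => lE; apply: fx; rewrite -lE.
by move=> z /andP[lz zx] fz; move: lz; rewrite ltNge ubE.
Qed.

Lemma bump_right_end f x : plact f x <> x -> exists2 r, plact f r = r &
  x < r /\ forall z, x <= z < r -> plact f z <> z.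
Proof.
move=> fx; have /andP[_ x1] : 0 <= x <= 1.
  by apply/negPn/negP => /(plact_out f).
pose E := [set z | plact f z = z /\ x <= z].
have E0 : E !=set0 by exists 1; rewrite /E /= plact_1.
have Ex : lbound E x by move=> z [].
have lbE : lbound E (inf E) by apply: inf_lbound; exists x.
have fE g : (forall z, E z -> plact g z = z) -> plact g (inf E) <= inf E.
  by move=> gE; apply: lb_le_inf => // z Ez; rewrite -(gE z Ez) ler_plact lbE.
have fr : plact f (inf E) = inf E.
  apply/eqP; rewrite eq_le fE /=; last by move=> z [].
  rewrite -(ler_plact f^-1%g) plactK fE// => z [fz _].
  by rewrite -{1}fz plactK.
have xr : x <= inf E by exact: lb_le_inf.
exists (inf E) => //; split.
  by rewrite lt_neqAle xr andbT; apply/eqP => rE; apply: fx; rewrite rE.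
by move=> z /andP[xz zr] fz; move: zr; rewrite ltNge lbE.
Qed.

Lemma affine_fix2 (m k x y : R) : x < y -> m * x + k = x -> m * y + k = y ->
  m = 1 /\ k = 0.
Proof.
move=> xy mx my; have : (m - 1) * (y - x) == 0 by apply/eqP; lra.
rewrite mulf_eq0 !subr_eq0 (gt_eqF xy) orbF => /eqP m1.
by split=> //; move: mx; rewrite m1; lra.
Qed.

(** On a component without breakpoints [f] would be affine up to both ends, which it fixes, hence
    the identity. So the support has finitely many components. *)
Lemma bump_breakpoint f : exists B : seq R, forall l x, bump f l x ->
  exists2 b, b \in B & bump f l b.
Proof.
have [B Baff] := plact_piecewise_affine f; exists B => l x fx.
have fxx := bump_moved fx; have [fl lx fN] := fx.
have [r fr [xr rN]] := bump_right_end fxx.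
apply: contrapT => noB.
have [|c cB|m [k fE]] := Baff l r; first exact: lt_trans xr.
  apply/negP => /andP[lc cr]; apply: noB; exists c => //; split=> // z.
  move=> /andP[lz zc]; have [zx|/ltW xz] := leP z x; first by apply: fN; rewrite lz.
  by apply: rN; rewrite xz (le_lt_trans zc).
have lr := lt_trans lx xr.
have [||m1 k0] := @affine_fix2 m k l r lr.
- by rewrite -fE ?fl// lexx ltW.
- by rewrite -fE ?fr// lexx ltW.
by apply: fxx; rewrite fE ?m1 ?k0 ?mul1r ?addr0// !ltW.
Qed.

Lemma bump_act f l x : bump f l x -> bump f l (plact f x).
Proof.
move=> [fl lx fN]; split=> //; first by rewrite -{1}fl ltr_plact.
move=> z /andP[lz zx] fz; apply: (fN z) => //.
by rewrite lz -(ler_plact f) fz.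
Qed.

Lemma plactV_fix f x : plact f^-1%g x = x <-> plact f x = x.
Proof. by split=> fx; rewrite -{1}fx (plactK, plactVK). Qed.

Lemma bumpV f l x : bump f l x -> bump f^-1%g l x.
Proof.
move=> [fl lx fN]; split; [exact/plactV_fix|by []|].
by move=> z /fN fz /plactV_fix.
Qed.

Lemma bump_actV f l x : bump f l x -> bump f l (plact f^-1%g x).
Proof. by move=> /bumpV/bump_act/bumpV; rewrite invgK. Qed.

Lemma bump_conj f g l x : bump f l x -> bump (f ^ g)%g (plact g l) (plact g x).
Proof.
move=> [fl lx fN]; split; first by rewrite conjgE !plactM plactK fl.
  by rewrite ltr_plact.
move=> z; rewrite -(plactVK g z) !(ltr_plact, ler_plact) => /fN fz.
by rewrite conjgE !plactM plactK => /plact_inj.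
Qed.

(** * Rigidity of centralizers on a component *)

(** If the forward orbit of [x] stayed above [e], its infimum would be a fixed point inside the
    component. *)
Lemma bump_shrink_down f l x e : bump f l x -> l < e -> plact f x < x ->
  exists n, plact (f ^+ n)%g x < e.
Proof.
move=> [fl lx fN] le fx; apply: contrapT => en.
have {}en n : e <= plact (f ^+ n)%g x by rewrite leNgt; apply/negP => ?; apply: en; exists n.
pose E := range (fun n => plact (f ^+ n)%g x).
have Ee : lbound E e by move=> _ [n _ <-].
have E0 : E !=set0 by exists x, 0%N; rewrite ?expg0 ?plact1.
have lbE : lbound E (inf E) by apply: inf_lbound; exists e.
have ei : e <= inf E by exact: lb_le_inf.
have ix : inf E <= x by apply: lbE; exists 0%N; rewrite ?expg0 ?plact1.
apply: (fN (inf E)); first by rewrite ix (lt_le_trans le).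
apply/eqP; rewrite eq_le -(ler_plact f^-1%g (inf E)) plactK; apply/andP; split.
  apply: lb_le_inf => // _ [[|n] _ <-].
    by rewrite expg0 plact1 (le_trans _ (ltW fx))// ler_plact.
  by rewrite expgSr plactM ler_plact lbE//; exists n.
apply: lb_le_inf => // _ [n _ <-].
by rewrite -(ler_plact f) plactVK lbE//; exists n.+1 => //; rewrite expgSr plactM.
Qed.

(** Take for [j] a power of [f] or of its inverse, whichever moves [x] down. Of its being a power,
    what is kept is that it commutes with the centralizer of [f]. *)
Lemma bump_shrink f l x e : bump f l x -> l < e ->
  exists j, [/\ forall k, commute k f -> commute k j, plact j l = l &
    plact j x < e].
Proof.
move=> fx le; have [fl _ _] := fx.
have fixX h n : plact h l = l -> plact (h ^+ n)%g l = l.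
  by move=> hl; elim: n => [|n IH]; rewrite ?expg0 ?plact1// expgS plactM hl.
have [fxx|xfx|/(bump_moved fx)//] := ltgtP (plact f x) x.
  have [n fn] := bump_shrink_down fx le fxx.
  exists (f ^+ n)%g; split=> [k kf||//]; [exact: commuteX|exact: fixX].
have [|n fn] := bump_shrink_down (bumpV fx) le.
  by rewrite -(ltr_plact f) plactVK.
exists (f^-1 ^+ n)%g; split=> [k kf||//]; last exact/fixX/plactV_fix.
exact/commuteX/commuteV.
Qed.

(* Near the left endpoint, [k] is affine and fixes the two points of the
   [f]-orbit of [p], hence is the identity there; the powers of [f] spread this
   to the whole component. *)
Lemma bump_rigid f k l p x : commute k f -> bump f l p -> plact k p = p ->
  bump f l x -> plact k x = x.
Proof.
move=> kf fp kp fx; have [e le [m [c kE]]] := plact_right_germ k l.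
have kfix j y : commute k j -> plact k y = y ->
    plact k (plact j y) = plact j y.
  by move=> kj ky; rewrite -plactM -kj plactM ky.
have ltj j y : plact j l = l -> l < y -> l < plact j y.
  by move=> jl ly; rewrite -jl ltr_plact.
have [_ lp _] := fp; have [_ lx _] := fx.
have [i [/(_ k kf) ki il ie]] := bump_shrink fp le.
(* The target [plact i p] forces a second fixed point of [k], distinct from the first. *)
have [j [/(_ k kf) kj jl ji]] := bump_shrink fp (ltj i p il lp).
have [||m1 c0] := @affine_fix2 m c _ _ ji.
- by rewrite -kE ?kfix// !ltW ?ltj// (lt_trans ji).
- by rewrite -kE ?kfix// !ltW ?ltj.
have [n [/(_ k kf) kn nl ne]] := bump_shrink fx le.
apply: (@plact_inj n); rewrite -plactM kn plactM kE ?m1 ?c0 ?mul1r ?addr0//.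
by rewrite !ltW ?ltj.
Qed.

(** * Elements commuting with a conjugate *)

(* Elements fixing [l] commute near [l] on the right, where they are affine. *)
Lemma bump_germ_commute f g l x : bump f l x -> plact g l = l ->
  exists2 y, bump f l y & plact g (plact f y) = plact f (plact g y).
Proof.
move=> fx gl; have [fl lx _] := fx.
have [d ld [m [c fE]]] := plact_right_germ f l.
have [e le [n [k gE]]] := plact_right_germ g l.
have ltV h a : plact h l = l -> l < a -> l < plact h^-1%g a.
  by move=> hl la; rewrite -(ltr_plact h) plactVK hl.
(* The last two bounds keep [plact f y] at most [e] and [plact g y] at most [d]. *)
pose y := Order.min (Order.min x (Order.min d e))
  (Order.min (plact f^-1%g e) (plact g^-1%g d)).
have ly : l < y by rewrite !lt_min lx ld le !ltV.
have : y <= y by [].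
rewrite {2}/y !le_min => /andP[/andP[yx /andP[yd ye]] /andP[fy gy]].
have lfy : l < plact f y by rewrite -fl ltr_plact.
have lgy : l < plact g y by rewrite -gl ltr_plact.
exists y; first by apply: bump_le fx _; rewrite ly.
have := fE l; rewrite lexx ltW// fl => /(_ isT) lE.
have := gE l; rewrite lexx ltW// gl => /(_ isT) lE'.
rewrite gE; last by rewrite ltW// -(ler_plact f^-1%g) plactK.
rewrite [RHS]fE; last by rewrite ltW// -(ler_plact g^-1%g) plactK.
rewrite fE ?gE ?yd ?ye ?(ltW ly)//.
(* Both affine pieces fix [l], so they are homotheties centred there. *)
have -> : c = (1 - m) * l by lra.
have -> : k = (1 - n) * l by lra.
by lra.
Qed.

Lemma commute_conj_eq f g : commute (f ^ g)%g f ->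
    (forall l x, bump f l x ->
      exists2 y, bump f l y & bump f l (plact g y)) ->
  (f ^ g)%g = f.
Proof.
set h := (f ^ g)%g => hf fg.
have hgE x : plact h (plact g x) = plact g (plact f x).
  by rewrite /h conjgE !plactM plactK.
have fg_stable l x : bump f l x -> plact g l = l /\ bump f l (plact g x).
  move=> fx; have [y fy fgy] := fg l x fx.
  have hgy := bump_conj g fy; have [hgl lgy _] := hgy.
  have [fl lgy' _] := fgy.
  (* Otherwise the larger of [l] and [plact g l] lies inside the component starting at the smaller
     one and is fixed by the other element. By rigidity that element would fix [plact g y], which
     both [f] and [h] move. *)
  have gl : plact g l = l.
    have [gl|lg|//] := ltgtP (plact g l) l; exfalso.
      apply: (bump_moved fgy).
      apply: (@bump_rigid h f (plact g l) l) => //.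
      by apply: bump_le hgy _; rewrite gl ltW.
    apply: (bump_moved hgy).
    apply: (@bump_rigid f h l (plact g l)) => //.
    by apply: bump_le fgy _; rewrite lg ltW.
  split=> //; have hgx := bump_conj g fx; have [_ lgx _] := hgx.
  rewrite gl in hgx hgy lgx; split=> // z lz fz.
  apply: (bump_moved fgy); apply: (@bump_rigid h f l z) => //.
  exact: bump_le hgx lz.
apply: eq_plact => x; have [fx|/eqP/bump_exists[l fx]] := eqVneq (plact f x) x.
  rewrite -{1}(plactVK g x) hgE fx; set z := plact g^-1%g x.
  suff -> : plact f z = z by rewrite plactVK.
  apply: contrapT => /bump_exists[l /fg_stable[_ /bump_moved]].
  by rewrite plactVK fx.
have [gl _] := fg_stable _ _ fx.
(* As [f] and [g] commute at [y], [h] and [f] agree at [plact g y]. Rigidity applied to [h * f^-1]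
   extends this to the component. *)
have [y fy gfy] := bump_germ_commute fx gl.
have [_ fgy] := fg_stable _ _ fy.
have := @bump_rigid f (h * f^-1)%g l (plact g y) x.
rewrite plactM hgE gfy plactK => /(_ _ fgy erefl fx) hfx.
apply: (@plact_inj f^-1%g); rewrite plactK -plactM hfx//.
by apply/commute_sym/commuteM; [exact/commute_sym|exact/commuteV].
Qed.

(** * Finite rational codes *)

(** The first clause does not mention components. When two elements share a code, it can be read for
    one and the second clause for the other. *)
Definition bump_code f (s : seq (rat * rat)) :=
  (forall q r, (q, r) \in s ->
    plact f (ratr q) < ratr r /\ plact f^-1%g (ratr q) < ratr r) /\
  (forall l x, bump f l x -> exists q r,
    [/\ (q, r) \in s, bump f l (ratr q) & bump f l (ratr r)]).

Lemma bump_larger f l x : bump f l x -> exists2 y, bump f l y & x < y.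
Proof.
move=> fx; have [xf|xf|/esym/(bump_moved fx)//] := ltgtP x (plact f x).
  by exists (plact f x) => //; exact: bump_act.
exists (plact f^-1%g x); first exact: bump_actV.
by rewrite -(ltr_plact f) plactVK.
Qed.

Lemma bump_code_exists f : exists s, bump_code f s.
Proof.
have pairP l b : bump f l b -> exists q r : rat,
    [/\ plact f (ratr q) < ratr r, plact f^-1%g (ratr q) < ratr r,
        bump f l (ratr q) & bump f l (ratr r)].
  move=> fb; have [_ lb _] := fb.
  have [q] := rat_in_itvoo lb; rewrite in_itv /= => /andP[lq qb].
  have fq : bump f l (ratr q) by apply: bump_le fb _; rewrite lq ltW.
  (* A component has no largest point, so there is room for [r] above both images. *)
  have [y fy] : exists2 y, bump f l y &
      Order.max (plact f (ratr q)) (plact f^-1%g (ratr q)) < y.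
    by apply: bump_larger; case: leP => _; [exact: bump_actV|exact: bump_act].
  move=> /rat_in_itvoo[r]; rewrite in_itv /= => /andP[qr ry].
  move: qr; rewrite gt_max => /andP[qr qr'].
  exists q, r; split=> //; apply: bump_le fy _; rewrite (ltW ry) andbT.
  by apply: lt_trans qr; have [] := bump_act fq.
have [B BP] := bump_breakpoint f.
have [s [s1 s2]] : exists s : seq (rat * rat),
    (forall q r, (q, r) \in s ->
      plact f (ratr q) < ratr r /\ plact f^-1%g (ratr q) < ratr r) /\
    (forall l b, b \in B -> bump f l b -> exists q r,
      [/\ (q, r) \in s, bump f l (ratr q) & bump f l (ratr r)]).
  elim: B {BP} => [|b B [s [s1 s2]]]; first by exists [::].
  have [fb|/eqP/bump_exists[l fb]] := eqVneq (plact f b) b.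
    exists s; split=> // l c; rewrite inE => /predU1P[->|].
      by move=> /bump_moved.
    exact: s2.
  have [q [r [q1 q2 fq fr]]] := pairP l b fb.
  exists ((q, r) :: s); split=> [q' r'|l' c].
    by rewrite inE => /predU1P[[-> ->]//|/s1].
  rewrite inE => /predU1P[->|cB fc]; last first.
    by have [q' [r' [qs ? ?]]] := s2 _ _ cB fc; exists q', r'; rewrite inE qs orbT.
  move=> fb'; exists q, r; rewrite inE eqxx.
  have [fl lb fN] := fb; have [fl' lb' fN'] := fb'.
  (* Left endpoints are fixed, so neither can lie inside the component of the other. *)
  have -> // : l' = l.
  have [ll|ll|//] := ltgtP l' l.
    by case: (fN' l); rewrite // ll ltW.
  by case: (fN l'); rewrite // ll ltW.
exists s; split=> // l x /BP[b bB]; exact: s2.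
Qed.

(** If [g] does not move [q] down, the image of [q] stays below [r]. If it does, the preimage of [q]
    lies between [q] and [r]. Either way [g] keeps a point of the component in it. *)
Lemma bump_code_inj f g s : bump_code f s -> bump_code g s ->
  commute (f ^ g)%g f -> (f ^ g)%g = f.
Proof.
move=> [_ sf] [sg _] /commute_conj_eq; apply=> l x /sf[q [r [qs fq fr]]].
have [gq gVq] := sg q r qs; have [_ lq _] := fq.
have [qg|gqq] := leP (ratr q) (plact g (ratr q)).
  exists (ratr q) => //; apply: bump_le fr _.
  by rewrite (lt_le_trans lq)// ltW.
exists (plact g^-1%g (ratr q)); last by rewrite plactVK.
apply: bump_le fr _; rewrite (ltW gVq) andbT.
by rewrite (lt_trans lq)// -(ltr_plact g) plactVK.
Qed.

End PLAction.

(** * Commutation in the wreath product *)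

Section HallWreath.
Variables (d : Order.disp_t) (Lambda : orderType d).
Implicit Types (l m : Lambda) (x : hall_space Lambda).

Definition top_below l x := forall m, (l < m)%O -> x m = 0.

Lemma hall_shift_in l h x : top_below l x ->
  hall_shift l h x = [fsfun x with l |-> x l + h].
Proof. by move=> lx; rewrite /= /hall_shift_fun asboolT. Qed.

Lemma hall_shift_out l h x : ~ top_below l x -> hall_shift l h x = x.
Proof. by move=> lx; rewrite /= /hall_shift_fun asboolF. Qed.

Lemma hall_shiftV l h : (hall_shift l h)^-1%g = hall_shift l (- h).
Proof. exact: symP. Qed.

Lemma symM (T : Type) (f g : sym T) t : (f * g)%g t = g (f t).
Proof. by []. Qed.

Lemma hall_shift_top l h x : top_below l x -> hall_shift l h x l = x l + h.
Proof. by move=> lx; rewrite hall_shift_in// fsfun_withE eqxx. Qed.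

Lemma top_below_shift l h x : top_below l x -> top_below l (hall_shift l h x).
Proof.
by move=> lx m lm; rewrite hall_shift_in// fsfun_withE gt_eqF// lx.
Qed.

Lemma top_below_lt l m x : (l < m)%O -> top_below l x -> top_below m x.
Proof. by move=> lm lx n mn; apply: lx; exact: lt_trans mn. Qed.

Lemma top_below_shiftN l m h x : (l < m)%O -> h != 0 -> top_below l x ->
  ~ top_below l (hall_shift m h x).
Proof.
move=> lm h0 lx /(_ m lm); rewrite hall_shift_top; last exact: top_below_lt lx.
by rewrite lx// add0r => /eqP; exact/negP.
Qed.

(** The inverse of [hall_shift m 1] acts first and puts -1 at [m], above [l], which makes
    [hall_shift l h] act trivially. *)
Lemma hall_shift_conj_top l m h x : (l < m)%O -> top_below l x ->
  (hall_shift l h ^ hall_shift m 1)%g x = x.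
Proof.
move=> lm lx; rewrite conjgE hall_shiftV !symM.
rewrite [hall_shift l h _]hall_shift_out; last exact: top_below_shiftN.
by rewrite -hall_shiftV -symM mulVg.
Qed.

(** The supports are disjoint: [hall_shift l 1] moves only points of [top_below l], which the
    conjugate fixes. *)
Lemma hall_shift_conj_commute l m : (l < m)%O ->
  commute (hall_shift l 1 ^ hall_shift m 1)%g (hall_shift l 1).
Proof.
move=> lm; apply: symP => x; rewrite [LHS]symM [RHS]symM.
have [lx|lx] := pselect (top_below l x).
  by rewrite !hall_shift_conj_top//; exact: top_below_shift.
rewrite (hall_shift_out _ lx) hall_shift_out// conjgE hall_shiftV !symM.
(* The conjugate must keep [x] outside [top_below l]: either it ends with a nonzero entry at [m], or
   it fixes [x]. *)
set y := hall_shift m (- 1) x; have [ly|ly] := pselect (top_below l y).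
  by apply: top_below_shiftN => //; exact: top_below_shift.
by rewrite (hall_shift_out _ ly) /y -hall_shiftV -symM mulVg.
Qed.

(** They differ at the zero function, which the conjugate fixes. *)
Lemma hall_shift_conj_neq l m : (l < m)%O ->
  (hall_shift l 1 ^ hall_shift m 1)%g <> hall_shift l 1.
Proof.
move=> lm /(congr1 (fun s : sym (hall_space Lambda) => s [fsfun] l)).
have l0 : top_below l [fsfun] by move=> n _; rewrite fsfun0E.
by rewrite hall_shift_conj_top// hall_shift_top// fsfun0E.
Qed.

Lemma hall_shift_mem l h :
  hall_shift l h \in generated (@hall_generators d Lambda).
Proof. by apply/mem_set => H [_]; apply; exists l, h. Qed.

Definition hall_gen l : hall_wreath Lambda := HallWreath (hall_shift_mem l 1).

Lemma hall_gen_conj_commute l m : (l < m)%O ->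
  commute (hall_gen l ^ hall_gen m)%g (hall_gen l).
Proof. by move=> lm; apply: val_inj; exact: hall_shift_conj_commute. Qed.

Lemma hall_gen_conj_neq l m : (l < m)%O ->
  (hall_gen l ^ hall_gen m)%g <> hall_gen l.
Proof. by move=> lm /(congr1 val); exact: hall_shift_conj_neq. Qed.

End HallWreath.

(** * Injectivity of the code on the generators *)

Lemma multiplicativeJ (G H : groupType) (phi : {multiplicative G -> H}) :
  {morph phi : a b / (a ^ b)%g}.
Proof. by move=> a b; apply: (mulgI (phi b)); rewrite -gmulfM -!conjgC gmulfM. Qed.

Theorem corollary1p2 (R : realType) (d : Order.disp_t) (Lambda : orderType d)
    (Lambda_uncountable : ~ countable [set: Lambda]) :
  ~ exists phi : {multiplicative hall_wreath Lambda -> PLo R}, injective phi.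
Proof.
move=> [phi phi_inj]; apply: Lambda_uncountable.
have /choice[code codeP] l := bump_code_exists (phi (hall_gen l)).
apply/countable_injP; exists (choice.pickle \o code) => l m _ _.
move=> /(pcan_inj choice.pickleK) lm.
(* The order matters: the conjugating generator must have the larger index. *)
have code_neq l1 l2 : code l1 = code l2 -> ~ (l1 < l2)%O.
  move=> c12 l12; apply: (hall_gen_conj_neq l12); apply: phi_inj.
  rewrite multiplicativeJ; apply: (bump_code_inj (codeP l1)); first by rewrite c12.
  by rewrite -multiplicativeJ; apply: gmulf_commute; exact: hall_gen_conj_commute.
by case: (ltgtP l m) => // [/(code_neq _ _ lm)|/(code_neq _ _ (esym lm))].
Qed.
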